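(* Let $k\ge 2$ and let $p_1,\ldots,p_k$ be nonnegative integers. The dual-opening gives a bijection between tree-pointed $k$-constellations of reduced type $(p_1,\ldots,p_k)$ and rooted $k$-nebulas of type $(p_1,\ldots,p_k)$.
   Context: $[m]=\{1,\ldots,m\}$. A map is a cellular embedding (all faces simply connected) of a connected graph (loops and multiple edges allowed) in an oriented compact connected surface without boundary, considered up to orientation preserving homeomorphism. A $k$-constellation is a map with black and white faces and with vertices of types $1,\ldots,k$ (types taken modulo $k$) such that (i) each edge separates a black face and a white face, and (ii) each black face has degree $k$ and is incident to vertices of type $1,2,\ldots,k$ in this order clockwise around the face. Black faces are called hyperedges. An edge has type $t\in[k]$ if, clockwise around its incident hyperedge, it goes from a vertex of type $t$ to a vertex of type $t+1$. A constellation is rooted if one hyperedge is distinguished (root hyperedge). It has type $(q_1,\ldots,q_k)$ if it has $q_t$ vertices of type $t$ for all $t$. For a vertex $v_0$ of a constellation $C$, a $v_0$-arborescence of $C$ is a spanning tree $A$ of $C$ such that every vertex $v\ne v_0$ of type $t$ is incident to exactly one edge of type $t$ in $A$. A tree-pointed $k$-constellation is a pair $(C,A)$ where $C$ is a rooted $k$-constellation and $A$ is a $v_0$-arborescence for some vertex $v_0$ (not necessarily incident to the root hyperedge). If $C$ has type $(q_1,\ldots,q_k)$ and $v_0$ has type $t$, then $(C,A)$ has reduced type $(p_1,\ldots,p_k)$ where $p_t=q_t-1$ and $p_s=q_s$ for $s\ne t$. A bud is a dangling half-edge (a half-edge not part of a complete edge). A $k$-nebula is a map having a single face, with black and white vertices,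 edges of types $1,\ldots,k$ and buds of types $1,\ldots,k$, such that (i) each edge joins a black and a white vertex; (ii) each black vertex has degree $k$ (counting buds); (iii) in clockwise order around a black vertex (resp. white vertex) the type of the edges or buds increases (resp. decreases) by one modulo $k$ from one half-edge to the next; (iv) for all $t\in[k]$ the number of buds of type $t$ incident to black vertices equals the number of buds of type $t$ incident to white vertices. It is rooted if one black vertex is distinguished (root vertex). It has type $(p_1,\ldots,p_k)$ if it has $p_t$ buds of type $t$ incident to black vertices, for all $t$. The dual $C^*$ of a $k$-constellation $C$ has a vertex in each face of $C$ (black or white according to the face) and an edge across each edge of $C$ (of the same type). The dual-opening of $(C,A)$, where $A$ is a spanning tree of $C$, is the map with buds obtained from $C^*$ by cutting into two halves each edge of $C^*$ crossing an edge of $A$ (an edge of type $t$ gives two buds of type $t$); its root vertex is the black vertex dual to the root hyperedge of $C$. *)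

(* Defs.v *)
From mathcomp Require Import all_boot all_fingroup.

Set Implicit Arguments.
Unset Strict Implicit.
Unset Printing Implicit Defensive.

(** A map (a connected graph cellularly embedded in an oriented closed surface,
    up to orientation-preserving homeomorphism) is encoded by its rotation
    system on half-edges, up to isomorphism.
    [rot h] is the half-edge following [h] in clockwise order around the vertex
    incident to [h]; [opp h] is the other half of the edge containing [h], with
    [opp h = h] exactly when [h] is a bud.  Vertices, edges and faces are sets
    of half-edges.  Every map with at least one edge or bud is represented; all
    the maps considered below are rooted at a face or a vertex of positive
    degree. *)
Record bmap := BMap {
  dart : finType;
  rot : {perm dart};
  opp : {perm dart} }.

Section Maps.
Variable G : bmap.
Implicit Types (x y h : dart G) (A : {set {set dart G}}) (s : seq (dart G)).

(** Leaving its vertex along [h] with the face on the right-hand side, and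
    turning right at the other end, one next follows [rot^-1 (opp h)]: the
    cycles of [face_perm] go clockwise around the faces, and the cycle of [h]
    is the face lying to the right of [h]. *)
Definition face_perm : {perm dart G} := (opp G * (rot G)^-1)%g.

Definition bud h := opp G h == h.

Definition vertex h : {set dart G} := porbit (rot G) h.
Definition edge h : {set dart G} := porbit (opp G) h.
Definition face h : {set dart G} := porbit face_perm h.

Definition vertices : {set {set dart G}} := [set vertex h | h : dart G].
Definition edges : {set {set dart G}} := [set edge h | h : dart G & ~~ bud h].
Definition faces : {set {set dart G}} := [set face h | h : dart G].

(** One step in the spanning subgraph with edge set [A]: move to another
    half-edge of the same vertex, or across an edge of [A]. *)
Definition step A : rel (dart G) :=
  fun x y => (y \in vertex x) || (edge x \in A) && (y == opp G x).

Definition connected_by A : Prop := forall x y, connect (step A) x y.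

Definition is_map_with_buds : Prop :=
  involutive (opp G) /\ connected_by edges.

Definition is_map : Prop := is_map_with_buds /\ forall h, ~~ bud h.

(** A simple cycle is given by its edges, each oriented by its first half:
    loops are simple cycles of length 1, and two parallel edges form one of
    length 2. *)
Definition simple_cycle A s : Prop :=
  [/\ s != [::],
      all (fun h => edge h \in A) s,
      path.cycle (fun h h' => vertex (opp G h) == vertex h') s,
      uniq [seq vertex h | h <- s] &
      uniq [seq edge h | h <- s]].

Definition spanning_tree A : Prop :=
  [/\ A \subset edges, connected_by A & forall s, ~ simple_cycle A s].

(** The dual map: its half-edge [h] lies in the face of [G] to the right of
    [h], and crosses the edge of [h]. *)
Definition dual_map : bmap := BMap face_perm (opp G).

Definition cut_fun A h := if edge h \in A then h else opp G h.

Lemma cut_inj A : injective (cut_fun A).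
Proof.
have E h : edge (opp G h) = edge h.
  by apply/eqP; rewrite eq_porbit_mem (mem_porbit _ 1).
move=> x y; rewrite /cut_fun; case: ifP => hx; case: ifP => hy.
- by [].
- by move=> xE; rewrite xE E hy in hx.
- by move=> yE; rewrite -yE E hx in hy.
- exact: perm_inj.
Qed.

Definition open_map A : bmap := BMap (rot G) (perm (@cut_inj A)).

End Maps.

Definition map_iso (G H : bmap) (f : dart G -> dart H) : Prop :=
  [/\ bijective f,
      forall h, f (rot G h) = rot H (f h) &
      forall h, f (opp G h) = opp H (f h)].

(** Types 1, ..., k are represented by [0, ..., k-1 : 'I_k], with cyclic
    successor [ordS].  [fblack h] tells whether the face to the right of [h] is
    black, and [vtype h] is the type of the vertex of [h]. *)
Record constellation (k : nat) := Constellation {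
  cmap :> bmap;
  fblack : pred (dart cmap);
  vtype : dart cmap -> 'I_k;
  croot : {set dart cmap} }.

Section Constellations.
Variables (k : nat) (C : constellation k).
Implicit Types (h : dart C) (A : {set {set dart C}}).

Definition is_constellation : Prop :=
  [/\ is_map C,
      forall h h', h' \in face h -> fblack h' = fblack h,
      forall h h', h' \in vertex h -> vtype h' = vtype h,
      forall h, fblack (opp C h) = ~~ fblack h &
      forall h, fblack h ->
        #|face h| = k /\ vtype (face_perm C h) = ordS (vtype h)].

Definition is_rooted_constellation : Prop :=
  is_constellation /\ exists2 h, fblack h & croot C = face h.

Definition num_vertices (t : 'I_k) : nat :=
  #|[set v in vertices C | [exists h in v, vtype h == t]]|.

(** The type of the edge containing [h]. *)
Definition etype h : 'I_k := if fblack h then vtype h else vtype (opp C h).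

Definition arborescence (v0 : {set dart C}) A : Prop :=
  [/\ v0 \in vertices C,
      spanning_tree A &
      forall h, vertex h != v0 ->
        #|[set e in A | ~~ [disjoint e & vertex h]
                      & [exists x in e, etype x == vtype h]]| = 1].

End Constellations.

Record constellation_with_edges (k : nat) := ConstellationWithEdges {
  tcon :> constellation k;
  tset : {set {set dart tcon}} }.

Definition is_tree_pointed k (X : constellation_with_edges k) : Prop :=
  is_rooted_constellation X /\ exists v0, arborescence v0 (tset X).

Definition has_reduced_type k (X : constellation_with_edges k)
    (p : 'I_k -> nat) : Prop :=
  exists2 h0 : dart X, arborescence (vertex h0) (tset X) &
    forall s, p s = num_vertices X s - (s == vtype h0).

Definition tree_pointed_iso k (X Y : constellation_with_edges k) : Prop :=
  exists f : dart X -> dart Y,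
    [/\ map_iso f,
        forall h, fblack (f h) = fblack h,
        forall h, vtype (f h) = vtype h,
        f @: croot X = croot Y &
        [set f @: (e : {set dart X}) | e in tset X] = tset Y].

(** [vblack h] tells whether the vertex of [h] is black, and [htype h] is the
    type of the edge or bud containing [h]. *)
Record nebula (k : nat) := Nebula {
  nmap :> bmap;
  vblack : pred (dart nmap);
  htype : dart nmap -> 'I_k;
  nroot : {set dart nmap} }.

Section Nebulas.
Variables (k : nat) (N : nebula k).
Implicit Types h : dart N.

Definition num_buds (b : bool) (t : 'I_k) : nat :=
  #|[set h : dart N | [&& bud h, vblack h == b & htype h == t]]|.

Record is_nebula : Prop := IsNebula {
  nebula_map : is_map_with_buds N;
  nebula_one_face : #|faces N| = 1;
  nebula_vblack : forall h h', h' \in vertex h -> vblack h' = vblack h;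
  nebula_htype : forall h, htype (opp N h) = htype h;
  nebula_edge : forall h, ~~ bud h -> vblack (opp N h) = ~~ vblack h;
  nebula_degree : forall h, vblack h -> #|vertex h| = k;
  nebula_rot_black : forall h, vblack h -> htype (rot N h) = ordS (htype h);
  nebula_rot_white :
    forall h, ~~ vblack h -> htype (rot N h) = ord_pred (htype h);
  nebula_balanced : forall t, num_buds true t = num_buds false t }.

Definition is_rooted_nebula : Prop :=
  is_nebula /\ exists2 h, vblack h & nroot N = vertex h.

Definition has_nebula_type (p : 'I_k -> nat) : Prop :=
  forall t, num_buds true t = p t.

End Nebulas.

Definition nebula_iso k (N N' : nebula k) : Prop :=
  exists f : dart N -> dart N',
    [/\ map_iso f,
        forall h, vblack (f h) = vblack h,
        forall h, htype (f h) = htype h &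
        f @: nroot N = nroot N'].

(** The half-edges of the dual are those of the constellation; its vertices are
    the faces of the constellation and its edges the same pairs of half-edges,
    so that the edges of the dual crossing [A] are the members of [A]. *)
Definition dual_opening k (X : constellation_with_edges k) : nebula k :=
  @Nebula k (open_map (G := dual_map X) (tset X))
    (@fblack k X) (@etype k X) (croot X).

(** [f] induces a bijection from the [isoS]-classes of objects satisfying [S]
    to the [isoT]-classes of objects satisfying [T]: it is well defined,
    injective and surjective on classes. *)
Definition bijection_on_classes (X Y : Type)
    (S : X -> Prop) (isoS : X -> X -> Prop)
    (T : Y -> Prop) (isoT : Y -> Y -> Prop) (f : X -> Y) : Prop :=
  [/\ forall x, S x -> T (f x),
      forall x x', S x -> S x' -> isoS x x' -> isoT (f x) (f x'),
      forall x x', S x -> S x' -> isoT (f x) (f x') -> isoS x x' &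
      forall y, T y -> exists2 x, S x & isoT (f x) y].

(* Main.v *)
(** The face of the dual-opening is the contour of the tree [A]: it runs along
    each edge of [A] twice, once through each of the two buds. In an
    arborescence the edges of [A], oriented from type [t] to type [t + 1],
    lead to the root, so that the contour goes away from the root at the
    buds of one colour and back at those of the other colour. Hence the two
    buds of each edge are matched as parentheses along the face of the
    nebula, and this matching recovers the constellation. Conversely, the
    parenthesis matching of the buds of a nebula joins buds of the same
    type, because the type of the current vertex of the contour changes by
    one at each bud, and glueing matched buds gives a constellation. The
    depth of parentheses is constant on its vertices, and each vertex except
    one has a single closing bud, which leads to a vertex of smaller depth:
    the glued edges form an arborescence. *)

From mathcomp Require Import all_boot all_fingroup.
Require Import Defs.

Set Implicit Arguments.
Unset Strict Implicit.
Unset Printing Implicit Defensive.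

(** * Orbits of permutations *)

Section Porbit.
Variable T : finType.
Implicit Types (s t : {perm T}) (x y z : T).

Lemma porbit_closed (P : T -> Prop) s x y :
  (forall z, P z -> P (s z)) -> P x -> y \in porbit s x -> P y.
Proof.
move=> sP Px /porbitP[i ->]; elim: i => [|i IH]; first by rewrite perm1.
by rewrite expgSr permM; apply: sP.
Qed.

(** Every point of the cycle reaches [b] after finitely many steps, so [P] spreads backwards from
    [b]. Since the walk stops at [b], nothing is asked of the step there. *)
Lemma porbit_backward (P : T -> Prop) s b y :
    P b -> (forall z, z \in porbit s b -> z != b -> P (s z) -> P z) ->
  y \in porbit s b -> P y.
Proof.
move=> Pb back; rewrite porbit_sym => /porbitP[i].
elim: i y => [|i IH] y yb; first by rewrite perm1 in yb; rewrite -yb.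
have [-> // | ney] := eqVneq y b.
apply: back => //.
  by rewrite porbit_sym yb mem_porbit.
by apply: IH; rewrite yb expgS permM.
Qed.

Lemma porbit_step s x : s x \in porbit s x.
Proof. exact: (mem_porbit s 1 x). Qed.

Lemma porbit_trans s x y z :
  y \in porbit s x -> z \in porbit s y -> z \in porbit s x.
Proof. by rewrite -eq_porbit_mem => /eqP->. Qed.

Lemma porbit_perm s x y : (s x \in porbit s y) = (x \in porbit s y).
Proof. by rewrite -!eq_porbit_mem (eqP (_ : porbit s (s x) == porbit s x)) //
  eq_porbit_mem porbit_step. Qed.

Lemma porbit_refine s t x y :
  (forall z, s z \in porbit t z) -> y \in porbit s x -> y \in porbit t x.
Proof.
move=> st; apply: (porbit_closed (P := fun z => z \in porbit t x));
  last exact: porbit_id.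
by move=> z xz; apply: porbit_trans xz (st z).
Qed.

Lemma porbit_connect (e : rel T) s x y :
  (forall z, connect e z (s z)) -> y \in porbit s x -> connect e x y.
Proof.
move=> se; apply: (porbit_closed (P := connect e x)); last exact: connect0.
by move=> z xz; apply: connect_trans xz (se z).
Qed.

End Porbit.

Lemma porbit_morph (T U : finType) (f : T -> U) (s : {perm T}) (t : {perm U})
    (x y : T) :
    injective f -> (forall z, f (s z) = t (f z)) ->
  (f y \in porbit t (f x)) = (y \in porbit s x).
Proof.
move=> f_inj fst.
have fX i : f ((s ^+ i)%g x) = (t ^+ i)%g (f x).
  by elim: i => [|i IH]; rewrite ?perm1 // !expgSr !permM fst IH.
by apply/porbitP/porbitP => -[i yE]; exists i;
  [apply: f_inj; rewrite fX | rewrite yE fX].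
Qed.

(** * Parentheses along a cycle *)

Section Matching.
Variable T : finType.
Implicit Types (s m : {perm T}) (O C : {set T}).

(** A matching extended by the identity, so that [m * s] is a permutation of all of [T]; its cycles
    are the vertices obtained by glueing matched parentheses. *)
Definition pairing O C m : Prop :=
  [/\ involutive m, forall x, x \in O -> m x \in C,
      forall x, x \in C -> m x \in O & forall x, x \notin O :|: C -> m x = x].

Definition separates s C : Prop :=
  forall x y, x \in C -> y \in C -> y \in porbit s x -> x = y.

(** Take an opening [a] and a closing [b] after it at minimal distance, so that no parenthesis lies
    strictly between. Composing with [tperm a b] splits the cycle into the arc from [s a] to [b] and
    the rest, which contains [a]. *)
Lemma innermost_pair s O C r :
    [disjoint O & C] -> O :|: C \subset porbit s r -> O != set0 -> C != set0 ->
  exists a b : T,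
    [/\ a \in O, b \in C,
        forall y, y \in porbit (tperm a b * s)%g b -> y \in O :|: C -> y = b &
        porbit s r \subset
          porbit (tperm a b * s)%g a :|: porbit (tperm a b * s)%g b].
Proof.
move=> dOC sub /set0Pn[a0 a0O] /set0Pn[b0 b0C].
have [a0r b0r] : a0 \in porbit s r /\ b0 \in porbit s r.
  by split; apply: (subsetP sub); rewrite inE ?a0O ?b0C ?orbT.
have exn : exists n, [exists a in O, (s ^+ n)%g a \in C].
  have /porbitP[n b0E] : b0 \in porbit s a0.
    by rewrite porbit_sym in a0r; apply: porbit_trans a0r b0r.
  by exists n; apply/existsP; exists a0; rewrite a0O -b0E.
case: (ex_minnP exn) => n /existsP[a /andP[aO bC]] n_min.
have n_gt0 : 0 < n.
  case: n bC {n_min} => // bC; rewrite perm1 in bC.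
  by have := disjointFr dOC aO; rewrite bC.
set b := (s ^+ n)%g a in bC *.
(* An opening in between would be closer to [b], a closing one closer to [a]. *)
have inner i : 0 < i < n -> (s ^+ i)%g a \notin O :|: C.
  move=> /andP[i_gt0 i_lt]; rewrite inE negb_or; apply/andP; split; apply/negP.
    move=> iO; have := n_min (n - i); rewrite leqNgt ltn_subrL i_gt0 n_gt0 /=.
    move=> H; apply: (notF (H _)); apply/existsP; exists ((s ^+ i)%g a).
    by rewrite iO -permM -expgD subnKC // ltnW.
  move=> iC; have := n_min i; rewrite leqNgt i_lt => H; apply: (notF (H _)).
  by apply/existsP; exists a; rewrite aO.
exists a, b; split => //.
- move=> y yb; have: exists2 i, 0 < i <= n & y = (s ^+ i)%g a.
    apply: (porbit_closed (P := fun y => exists2 i, 0 < i <= n & _ ) _ _ yb).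
      move=> z [i /andP[i_gt0 i_le] ->]; rewrite permM.
      have [-> | i_neq] := eqVneq i n.
        by exists 1; rewrite ?n_gt0 // tpermR expg1.
      have i_lt : i < n by rewrite ltn_neqAle i_neq.
      have := inner i; rewrite i_gt0 i_lt inE negb_or => /(_ isT)/andP[iO iC].
      exists i.+1; first by rewrite i_lt.
      rewrite tpermD ?expgSr ?permM //; apply: contraTneq isT => iE.
        by rewrite -iE aO in iO.
      by rewrite -iE bC in iC.
    by exists n; rewrite ?n_gt0 ?leqnn.
  move=> [i /andP[i_gt0 i_le] ->] iOC; congr ((s ^+ _)%g _); apply/eqP.
  by move: iOC; apply: contraLR => i_neq; apply: inner;
    rewrite i_gt0 ltn_neqAle i_neq.
have ar : porbit s r = porbit s a.
  by apply/eqP; rewrite eq_porbit_mem porbit_sym; apply: (subsetP sub);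
    rewrite inE aO.
apply/subsetP => y; rewrite ar => ya; rewrite inE; apply/orP.
apply: (porbit_closed (P := fun y => _ \/ _) _ _ ya); last by left;
  apply: porbit_id.
move=> z zab.
have [-> | neza] := eqVneq z a.
  by right; have := porbit_step (tperm a b * s)%g b; rewrite permM tpermR.
have [-> | nezb] := eqVneq z b.
  by left; have := porbit_step (tperm a b * s)%g a; rewrite permM tpermL.
suff -> : s z = (tperm a b * s)%g z by rewrite !porbit_perm.
by rewrite permM tpermD // eq_sym.
Qed.

(* Read along the cycle of [s], the elements of [O] open and those of [C] close
   parentheses.  The depth [d] and the orbits of [m * s] are those of the plane
   tree whose contour is this word; [z0] is its root, and every other orbit has
   a single element of [C], leading to the parent. *)
Lemma matching_exists (W : Type) (up down : W -> W) (w : T -> W) s O C r :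
    cancel down up -> [disjoint O & C] -> #|O| = #|C| ->
    O :|: C \subset porbit s r ->
    (forall x, x \in O -> w (s x) = down (w x)) ->
    (forall x, x \in C -> w (s x) = up (w x)) ->
    (forall x, x \notin O :|: C -> w (s x) = w x) ->
  exists (m : {perm T}) (d : T -> nat) (z0 : T),
    [/\ pairing O C m /\ separates (m * s)%g C,
        forall x, w ((m * s)%g x) = w x,
        forall x, d ((m * s)%g x) = d x,
        forall x, x \in C -> d x = (d (m x)).+1 &
        forall x, x \in porbit s r -> x \notin porbit (m * s)%g z0 ->
          exists2 y, y \in C & y \in porbit (m * s)%g x].
Proof.
move=> upK; elim: {O}#|O| {-2}O (erefl #|O|) s C r => [|n IH] O cO s C r dOC cC
  sub wO wC w0.
  have O0 : O = set0 by apply/eqP; rewrite -cards_eq0 cO.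
  have C0 : C = set0 by apply/eqP; rewrite -cards_eq0 -cC cO.
  (* Without parentheses the tree is reduced to its root. *)
  exists 1%g, (fun=> 0), r; rewrite mul1g; split => //.
  - split; last by move=> x y; rewrite C0 inE.
    by split=> [x|x|x|x _]; rewrite ?perm1 ?O0 ?C0 ?inE.
  - by move=> x; apply: w0; rewrite O0 C0 !inE.
  - by move=> x; rewrite C0 inE.
  - by move=> x ->.
have O_neq0 : O != set0 by rewrite -cards_eq0 cO.
have C_neq0 : C != set0 by rewrite -cards_eq0 -cC cO.
have [a [b [aO bC Yb rab]]] := innermost_pair dOC sub O_neq0 C_neq0.
set s' := (tperm a b * s)%g in Yb rab.
have s'a : s' a = s b by rewrite permM tpermL.
have s'b : s' b = s a by rewrite permM tpermR.
have s'D x : x != a -> x != b -> s' x = s x.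
  by move=> xa xb; rewrite permM tpermD // eq_sym.
have nab : a != b by apply: contraTneq aO => ->; rewrite (disjointFl dOC).
have aC : a \in C = false by apply: disjointFr dOC aO.
have bO : b \in O = false by apply: disjointFl dOC bC.
set Y := porbit s' b.
have aY : a \notin Y.
  by apply: contra nab => aY; rewrite (Yb a) // inE aO.
(* No parenthesis precedes [b] on its arc, so [w] is constant there. Hence [up] at [b] undoes [down]
   at [a], and both points become neutral for the word read along [s']. *)
have wab : w (s a) = w b.
  have: s a \in Y by rewrite -s'b porbit_step.
  apply: (porbit_backward (P := fun z => w z = w b)) => // z zY nzb.
  have zOC : z \notin O :|: C by apply: contra nzb => zOC; rewrite (Yb z).
  rewrite s'D ?w0 //; apply: contraNneq aY => <- //.
pose O' := O :\ a; pose C' := C :\ b.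
have OC' x : x \notin O' :|: C' -> [\/ x = a, x = b | x \notin O :|: C].
  rewrite !inE; have [->|_] := eqVneq x a; first by constructor 1.
  by have [->|_] := eqVneq x b; [constructor 2 | constructor 3].
have sOC' x : x \in O' :|: C' -> [/\ x \in O :|: C, x != a & x != b].
  rewrite !inE; have [->|_] := eqVneq x a; first by rewrite aC andbF.
  by have [->|_] := eqVneq x b; rewrite ?bO.
have [|||||||m' [d' [z0 [[[m'K m'O m'C m'0] sep] wm' dm' dC' root]]]] :=
  IH O' _ s' C' a.
- by apply/eqP; rewrite -eqSS -cO (cardsD1 a O) aO.
- by apply: disjointWl (subD1set _ _) (disjointWr (subD1set _ _) dOC).
- by move: cC; rewrite (cardsD1 a O) (cardsD1 b C) aO bC => -[].
- apply/subsetP => x /sOC'[xOC xa xb].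
  have := subsetP rab x (subsetP sub x xOC); rewrite inE => /orP[// | xY].
  by rewrite (Yb x) ?eqxx in xb.
- by move=> x; rewrite !inE => /andP[xa xO]; rewrite s'D ?wO //;
  apply: contraTneq xO => ->; rewrite bO.
- by move=> x; rewrite !inE => /andP[xb xC]; rewrite s'D ?wC //;
  apply: contraTneq xC => ->; rewrite aC.
- move=> x /OC'[->|->|xOC].
  + by rewrite s'a wC // -wab wO // upK.
  + by rewrite s'b.
  + by rewrite s'D ?w0 //; apply: contraNneq xOC => ->;
    rewrite inE ?aO ?bC ?orbT.
(* Adding the pair to [m'] compensates the surgery on [s]: the orbits are those of the induction
   hypothesis. *)
have m's : (m' * tperm a b * s)%g = (m' * s')%g by rewrite -mulgA.
have aF : m' a = a by apply: m'0; rewrite !inE eqxx aC andbF.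
have bF : m' b = b by apply: m'0; rewrite !inE eqxx bO andbF.
have m'a x : (m' x == a) = (x == a) by rewrite -{1}aF (inj_eq perm_inj).
have m'b x : (m' x == b) = (x == b) by rewrite -{1}bF (inj_eq perm_inj).
have m'D x : x != a -> x != b -> (m' * tperm a b)%g x = m' x.
  by move=> xa xb; rewrite permM tpermD // eq_sym ?m'a ?m'b.
have mY y : y \in Y -> m' y = y.
  move=> yY; apply: m'0; apply/negP => /sOC'[yOC ya yb].
  by rewrite (Yb y) ?eqxx in yb.
(* The arc [Y] is a leaf of the tree, attached to the vertex of [a], whence its depth. *)
exists (m' * tperm a b)%g, (fun x => if x \in Y then (d' a).+1 else d' x), z0.
have ma : (m' * tperm a b)%g a = b by rewrite permM aF tpermL.
have mb : (m' * tperm a b)%g b = a by rewrite permM bF tpermR.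
rewrite m's; split.
- split; first split.
  + move=> x; have [->|xa] := eqVneq x a; first by rewrite ma mb.
    have [->|xb] := eqVneq x b; first by rewrite mb ma.
    by rewrite (m'D x) // m'D ?m'K ?m'a ?m'b.
  + move=> x xO; have [->|xa] := eqVneq x a; first by rewrite ma.
    rewrite m'D //; last by apply: contraTneq xO => ->; rewrite bO.
    by have := m'O x; rewrite !inE xa xO => /(_ isT)/andP[].
  + move=> x xC; have [->|xb] := eqVneq x b; first by rewrite mb.
    rewrite m'D //; last by apply: contraTneq xC => ->; rewrite aC.
    by have := m'C x; rewrite !inE xb xC => /(_ isT)/andP[].
  + move=> x xOC; rewrite m'D; first last.
    * by apply: contraNneq xOC => ->; rewrite inE bC orbT.
    * by apply: contraNneq xOC => ->; rewrite inE aO.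
    by apply: m'0; apply: contra xOC => /sOC'[].
  + have bY y : y \in porbit (m' * s')%g b -> y \in C -> y = b.
      move=> yb yC; apply: Yb; last by rewrite inE yC orbT.
      apply: (porbit_closed (P := fun z => z \in Y) _ _ yb);
        last exact: porbit_id.
      by move=> z zY; rewrite permM mY // porbit_perm.
    move=> x y xC yC xy.
    have [xb|xb] := eqVneq x b; first by rewrite xb [RHS]bY // -xb.
    have [yb|yb] := eqVneq y b; first by rewrite yb [LHS]bY // porbit_sym -yb.
    by apply: sep xy; rewrite !inE ?xb ?yb.
- exact: wm'.
- move=> x; rewrite dm'; congr (if _ then _ else _).
  apply/idP/idP => [|xY]; last by rewrite permM mY // porbit_perm.
  rewrite permM porbit_perm => xY.
  by have /perm_inj <- := mY _ xY.
- move=> x xC; have [->|xb] := eqVneq x b.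
    by rewrite mb porbit_id (negPf aY).
  rewrite m'D //; last by apply: contraTneq xC => ->; rewrite aC.
  have xC' : x \in C' by rewrite !inE xb.
  have nY y : y \in O' :|: C' -> y \in Y = false.
    by move=> /sOC'[yOC _ yb]; apply: contraNF yb => yY; rewrite (Yb y).
  have xY : (x \in Y) = false by apply: nY; rewrite inE xC' orbT.
  have mxY : (m' x \in Y) = false by apply: nY; rewrite inE m'C.
  by rewrite xY mxY dC'.
move=> x xr xz0; have := subsetP rab x xr; rewrite inE => /orP[xa|xY].
  by have [y] := root x xa xz0; rewrite !inE => /andP[_ yC] xy; exists y.
exists b => //; move: xY.
apply: (porbit_backward (P := fun z => b \in porbit (m' * s')%g z));
  first exact: porbit_id.
move=> z zY _; apply: porbit_trans.
by have := porbit_step (m' * s')%g z; rewrite [in X in X \in _ -> _]permM mY.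
Qed.

Lemma pairing_card O C m : pairing O C m -> #|O| = #|C|.
Proof.
move=> [mK mO mC _]; apply/eqP; rewrite eqn_leq.
by rewrite -{1}(card_imset O (@perm_inj _ m)) -{2}(card_imset C (@perm_inj _
  m));
  apply/andP; split; apply/subset_leq_card/subsetP => _ /imsetP[x xP ->]; auto.
Qed.

(* The close matched with an open [a] shares its [m * s]-orbit with [s a], hence
   with the next close along [s] when no open lies in between. *)
Lemma pairing_unique s O C r m1 m2 :
    [disjoint O & C] -> O :|: C \subset porbit s r ->
    pairing O C m1 -> pairing O C m2 ->
    separates (m1 * s)%g C -> separates (m2 * s)%g C ->
  m1 = m2.
Proof.
elim: {O}#|O| {-2}O (erefl #|O|) s C r m1 m2 => [|n IH] O cO s C r m1 m2 dOC
  sub pm1 pm2 sep1 sep2.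
  have O0 : O = set0 by apply/eqP; rewrite -cards_eq0 cO.
  have C0 : C = set0 by apply/eqP; rewrite -cards_eq0 -(pairing_card pm1) cO.
  case: pm1 pm2 => _ _ _ m10 [_ _ _ m20].
  by apply/permP => x; rewrite m10 ?m20 // O0 C0 !inE.
have O_neq0 : O != set0 by rewrite -cards_eq0 cO.
have C_neq0 : C != set0 by rewrite -cards_eq0 -(pairing_card pm1) cO.
have [a [b [aO bC Yb rab]]] := innermost_pair dOC sub O_neq0 C_neq0.
set s' := (tperm a b * s)%g in Yb rab.
have s'b : s' b = s a by rewrite permM tpermR.
have nab : a != b by apply: contraTneq aO => ->; rewrite (disjointFl dOC).
have ma m : pairing O C m -> separates (m * s)%g C -> m a = b.
  move=> [mK mO mC m0] sep; apply: sep => //; first exact: mO.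
  have: s a \in porbit s' b by rewrite -s'b porbit_step.
  move=> sab; have : b \in porbit (m * s)%g (s a).
    apply: (porbit_backward (P := fun z => b \in porbit (m * s)%g z) _ _ sab).
      exact: porbit_id.
    move=> z zb nzb; have zOC : z \notin O :|: C by apply: contra nzb => zOC;
      rewrite (Yb z).
    have nza : z != a by apply: contraNneq zOC => ->; rewrite inE aO.
    rewrite permM tpermD // 1?eq_sym // => H.
    by apply: porbit_trans (porbit_step _ _) _; rewrite permM m0.
  apply: porbit_trans.
  by have := porbit_step (m * s)%g (m a);
    rewrite [in X in X \in _ -> _]permM mK.
pose O' := O :\ a; pose C' := C :\ b.
have pairing' m : pairing O C m -> m a = b ->
    pairing O' C' (m * tperm a b)%g.
  move=> [mK mO mC m0] mab; have mba : m b = a by rewrite -mab mK.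
  have m_a x : (m x == b) = (x == a) by rewrite -mab (inj_eq perm_inj).
  have m_b x : (m x == a) = (x == b) by rewrite -{1}mba (inj_eq perm_inj).
  have mD x : x != a -> x != b -> (m * tperm a b)%g x = m x.
    by move=> xa xb; rewrite permM tpermD // eq_sym ?m_a ?m_b.
  have mta : (m * tperm a b)%g a = a by rewrite permM mab tpermR.
  have mtb : (m * tperm a b)%g b = b by rewrite permM mba tpermL.
  split.
  - move=> x; have [->|xa] := eqVneq x a; first by rewrite !mta.
    have [->|xb] := eqVneq x b; first by rewrite !mtb.
    by rewrite (mD x) // mD ?mK ?m_a ?m_b.
  - move=> x; rewrite !inE => /andP[xa xO];
    have xb : x != b by apply: contraTneq xO => ->; rewrite (disjointFl dOC).
    by rewrite mD // m_a xa mO.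
  - move=> x; rewrite !inE => /andP[xb xC];
    have xa : x != a by apply: contraTneq xC => ->; rewrite (disjointFr dOC).
    by rewrite mD // m_b xb mC.
  - move=> x; rewrite !inE; have [->|xa] := eqVneq x a; first by rewrite mta.
    have [->|xb] := eqVneq x b; first by rewrite mtb.
    by move=> xOC; rewrite mD // m0 // inE.
(* Removing the pair from both factors leaves the product, and so its orbits, unchanged. *)
have sep' m : separates (m * s)%g C -> separates (m * tperm a b * s')%g C'.
  move=> sep x y; rewrite !inE => /andP[_ xC] /andP[_ yC].
  have -> : (m * tperm a b * s' = m * s)%g by rewrite -mulgA tpermKg.
  exact: sep.
have pm1' := pairing' m1 pm1 (ma _ pm1 sep1).
have pm2' := pairing' m2 pm2 (ma _ pm2 sep2).
apply: (mulIg (tperm a b)); apply: (IH O' _ s' C' a) => //; last 2 first.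
- exact: sep'.
- exact: sep'.
- by apply/eqP; rewrite -eqSS -cO (cardsD1 a O) aO.
- by apply: disjointWl (subD1set _ _) (disjointWr (subD1set _ _) dOC).
apply/subsetP => x xOC'.
have [xOC xb] : x \in O :|: C /\ x != b.
  move: xOC'; rewrite !inE => /orP[/andP[_ xO]|/andP[-> ->]];
    last by rewrite orbT.
  by rewrite xO; split=> //; apply: contraTneq xO => ->;
    rewrite (disjointFl dOC).
have := subsetP rab x (subsetP sub x xOC); rewrite inE => /orP[// | xY].
by rewrite (Yb x) ?eqxx in xb.
Qed.

End Matching.

(* Induction on the number of levels below [x]: the contour [m * s] goes around
   the orbit of [x], making a complete excursion at each child. *)
Lemma contour_returns (T : finType) (s m : {perm T}) (B : {set T})
    (d : T -> nat) (x : T) :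
    involutive m -> separates s B -> (forall y, d (s y) = d y) ->
    (forall y, y \in B -> d (m y) < d y) ->
    (forall y, m y != y -> y \in B \/ m y \in B) ->
  m x \in porbit (m * s)%g x.
Proof.
move=> mK sep ds dm mB; set t := (m * s)%g.
suff up h : h \in B -> h \in porbit t (m h).
  have [->|/mB[xB|mxB]] := eqVneq (m x) x; first exact: porbit_id.
    by rewrite porbit_sym up.
  by have := up _ mxB; rewrite mK.
have [n] := ubnP (\max_y d y - d h); elim: n h => // n IH h;
  rewrite ltnS => lt_n hB.
(* Walk along the [s]-orbit from [s h] to [h]. By separation any other [z] there is either fixed by
   [m] or matched with a deeper element of [B]; in the latter case the induction hypothesis brings
   the contour from [z] to [m z], and its next step is [s z]. *)
have sh : h \in porbit t (s h).
  apply: (porbit_backward (P :=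
    fun z => h \in porbit t z) _ _ (_ : _ \in porbit s h)).
  - exact: porbit_id.
  - move=> z zh nzh; apply: porbit_trans.
    have dz : d z = d h.
      by apply: (porbit_closed (P := fun z => d z = d h) _ _ zh) => // y;
        rewrite ds.
    have zB : z \notin B by apply: contra nzh => zB; rewrite (sep h z).
    have [mz|/mB[zB'|mzB]] := eqVneq (m z) z.
    + by have := porbit_step t z; rewrite [in X in X \in _ -> _]permM mz.
    + by rewrite zB' in zB.
    have dmz := dm _ mzB; rewrite mK in dmz.
    have := IH (m z) _ mzB; rewrite mK => zmz.
    apply: (@porbit_trans _ _ _ (m z)); last first.
      by have := porbit_step t (m z); rewrite [in X in X \in _ -> _]permM mK.
    rewrite zmz //; apply: leq_trans lt_n.
    by rewrite ltn_sub2l // -dz // (leq_trans dmz) // leq_bigmax.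
  - exact: porbit_step.
apply: porbit_trans sh.
by have := porbit_step t (m h); rewrite [in X in X \in _ -> _]permM mK.
Qed.

Lemma connect_ind (T : finType) (e : rel T) (P : T -> Prop) x y :
  (forall z t, P z -> e z t -> P t) -> P x -> connect e x y -> P y.
Proof.
move=> Pe Px /connectP[p xp ->]; elim: p x Px xp => //= z p IH x Px /andP[xz].
by apply: IH; apply: Pe xz.
Qed.

Lemma uniq_map_inj (T U : eqType) (f : T -> U) (s : seq T) :
  uniq [seq f x | x <- s] -> {in s &, injective f}.
Proof.
elim: s => //= x s IH /andP[xs /IH{}IH] y z; rewrite !inE.
by case: (eqVneq y x) (eqVneq z x) => [->|_] [->|_] //= ys zs eq_f;
  [case/mapP: xs; exists z | case/mapP: xs; exists y | apply: IH].
Qed.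

(** * Cycles and depth in maps *)

Section Bmap.
Variable G : bmap.
Implicit Types (x y z h g : dart G) (A : {set {set dart G}}).
Implicit Types (B : {set dart G}) (s : seq (dart G)).

Lemma edge_opp h : edge (opp G h) = edge h.
Proof. by apply/eqP; rewrite eq_porbit_mem porbit_step. Qed.

Lemma mem_vertex x : x \in vertex x. Proof. exact: porbit_id. Qed.

Lemma vertex_eq x y : (vertex x == vertex y) = (x \in vertex y).
Proof. exact: eq_porbit_mem. Qed.

Lemma vertex_const (U : Type) (f : dart G -> U) x y :
  (forall h, f (rot G h) = f h) -> y \in vertex x -> f y = f x.
Proof. by move=> fr; apply: (porbit_closed (P := fun z => f z = f x)) => // z;
  rewrite fr. Qed.

Lemma edgeE h : involutive (opp G) -> edge h = [set h; opp G h].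
Proof.
move=> oK; apply/setP => x; rewrite !inE; apply/idP/idP.
  apply: (porbit_closed (P := fun z => (z == h) || (z == opp G h))).
    by move=> z /orP[]/eqP->; rewrite ?oK eqxx ?orbT.
  by rewrite eqxx.
by case/orP=> /eqP->; rewrite ?porbit_step ?porbit_id.
Qed.

Lemma edge_eq x y : involutive (opp G) ->
  edge x = edge y -> x = y \/ x = opp G y.
Proof.
move=> oK exy; have := porbit_id (opp G) x;
  rewrite -/(edge x) exy edgeE // !inE.
by case/orP => /eqP; [left | right].
Qed.

Lemma step_vertex A x y : y \in vertex x -> connect (step A) x y.
Proof. by move=> xy; apply: connect1; rewrite /step xy. Qed.

Lemma step_opp A x : edge x \in A -> connect (step A) x (opp G x).
Proof. by move=> xA; apply: connect1; rewrite /step xA eqxx orbT. Qed.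

(** A step along a face crosses an edge, or stays put at a bud, and then moves around a vertex. *)
Lemma one_face_connected : (forall x y, y \in face x) -> connected_by (edges G).
Proof.
move=> one x y; apply: (porbit_connect (s := face_perm G)) (one x y) => z.
rewrite permM; apply: (@connect_trans _ _ (opp G z)).
  have [zb|nb] := boolP (bud z); first by rewrite (eqP zb).
  by apply: step_opp; apply: imset_f; rewrite inE.
by apply: step_vertex; rewrite -(porbit_perm (rot G)) permKV; apply: mem_vertex.
Qed.

(* At a vertex of maximal depth on the cycle, both edges of the cycle go to the
   parent. *)
Lemma graded_acyclic A B (d : dart G -> nat) :
    separates (rot G) B -> involutive (opp G) ->
    (forall h, d (rot G h) = d h) ->
    (forall h, h \in B -> d (opp G h) < d h) ->
    (forall h, edge h \in A -> h \in B \/ opp G h \in B) ->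
  forall s, ~ simple_cycle A s.
Proof.
move=> sep oK dr dB AB s [s0 sA scyc _ sE].
have dv x y : vertex x = vertex y -> d x = d y.
  by move/eqP; rewrite vertex_eq; apply: vertex_const dr.
have [h0 h0s] : exists h, h \in s by case: (s) s0 => // h ? _; exists h;
  rewrite mem_head.
case: (arg_maxnP d h0s) => h hs h_max.
have hmax x : x \in s -> d x <= d h by move=> xs; apply: h_max.
pose g := path.prev s h.
have gs : g \in s by rewrite mem_prev.
have /eqP gh : vertex (opp G g) == vertex h by apply: (prev_cycle scyc).
have /eqP hn : vertex (opp G h) == vertex (path.next s h) by apply: (next_cycle
  scyc).
have hB : h \in B.
  have [//|ohB] := AB h (allP sA h hs).
  have := dB _ ohB; rewrite oK (dv _ _ hn) ltnNge hmax //.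
  by rewrite mem_next.
have ogB : opp G g \in B.
  have [gB|//] := AB g (allP sA g gs).
  by have := dB _ gB; rewrite (dv _ _ gh) ltnNge hmax.
(* The cycle enters and leaves this vertex through the same element of [B]. Its edges being
   distinct, it is a loop, whose ends would have different depths. *)
have hog : h = opp G g by apply: sep => //; rewrite -[_ \in _]vertex_eq gh.
have gE : g = h.
  apply: (uniq_map_inj sE) => //; first last.
  by rewrite hog edge_opp.
by have := dB h hB; rewrite {2}hog gE ltnn.
Qed.

Definition climb B : rel (dart G) :=
  fun x y => (y \in vertex x) || (x \in B) && (y == opp G x).

(** A closed climb contains a simple cycle: shorten it as long as it repeats a vertex. Distinct
    elements of [B] lie on distinct edges, because [B] never contains both halves of an edge. *)
Lemma climb_cycle A B h :
    involutive (opp G) ->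
    (forall g, g \in B -> edge g \in A) -> (forall g, g \in B ->
      opp G g \notin B) ->
    h \in B -> connect (climb B) (opp G h) h ->
  exists s, simple_cycle A s.
Proof.
move=> oK BA Bo hB hh.
pose e := [rel g g' | (g' \in B) && (vertex (opp G g) == vertex g')].
(* Keep only the darts of [B] that are crossed; the moves around vertices become the relation
   [e]. *)
have [p hp] : exists s, (s != [::]) && path.cycle e s.
  have [g [gB /connectP[p hp gp] hg]] :
      exists g, [/\ g \in B, connect e h g & h \in vertex (opp G g)].
    apply: (connect_ind (P := fun y => exists g, [/\ g \in B, connect e h g & y
      \in vertex (opp G g)]) _ _ hh).
      move=> y z [g [gB hg yg]] /orP[zy | /andP[yB /eqP->]].
        by exists g; split => //; apply: porbit_trans yg zy.
      exists y; split; rewrite ?mem_vertex //;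
        apply: connect_trans hg (connect1 _).
      by rewrite /= yB eq_sym vertex_eq.
    by exists h; split; rewrite ?mem_vertex.
  by exists (h :: p); rewrite /= rcons_path hp -gp /= hB eq_sym vertex_eq.
have [n] := ubnP (size p); elim: n p hp => // n IH s /andP[s0 scyc] lt_n.
have sB x : x \in s -> x \in B.
  by move=> xs; have /andP[] := prev_cycle scyc xs.
have [us|] := boolP (uniq [seq vertex x | x <- s]).
  exists s; split => //.
  - by apply/allP => x /sB/BA.
  - by apply: sub_cycle scyc => x y /andP[].
  rewrite map_inj_in_uniq ?(map_uniq us) // => x y /sB xB /sB yB /edge_eq[] //
    xy.
  by have := Bo _ yB; rewrite -xy xB.
case/(uniqPn set0) => i [j [lt_ij lt_j eq_ij]]; rewrite size_map in lt_j.
have lt_i := ltn_trans lt_ij lt_j.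
rewrite !(nth_map h) // in eq_ij.
set x := nth h s i in eq_ij; set y := nth h s j in eq_ij.
pose u := drop i.+1 s; pose k := j - i.+1.
have lt_k : k < size u by rewrite size_drop ltn_sub2r // (leq_ltn_trans lt_ij).
have yE : y = nth h u k by rewrite nth_drop subnKC.
(* Start the cycle at the earlier visit [x] of the repeated vertex: the segment before the later
   visit [y] is closed and shorter. *)
have sE : seq.rot i s = x :: take k u ++ y :: (drop k.+1 u ++ take i s).
  rewrite /seq.rot (drop_nth h lt_i) -/x -/u cat_cons -cat_cons; congr (_ :: _).
  by rewrite yE -cat_cons -drop_nth // catA cat_take_drop.
apply: (IH (x :: take k u)); last first.
  by rewrite /= size_takel ?(ltnW lt_k) //; rewrite -ltnS;
    apply: leq_trans lt_n; rewrite ltnS (leq_ltn_trans _ lt_j) // /k ltn_subrL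
      /=; apply: leq_trans lt_ij.
move: scyc; rewrite -(rot_cycle i) sE /= rcons_cat cat_path.
case/and3P => px /andP[_ /eqP lasty] _.
by rewrite /= rcons_path px /= lasty eq_ij eqxx sB ?mem_nth.
Qed.

(** The number of darts reachable by climbing is a depth: from [h] one reaches all that [opp G h]
    reaches, and also [h] itself. *)
Lemma climb_grading B :
    (forall h, h \in B -> ~~ connect (climb B) (opp G h) h) ->
  exists d : dart G -> nat,
    (forall h, d (rot G h) = d h) /\ forall h, h \in B -> d (opp G h) < d h.
Proof.
move=> acyc; exists (fun x => #|connect (climb B) x|); split=> h.
  apply: eq_card => y; have c1 : climb B h (rot G h) by rewrite /climb
    porbit_step.
  have c2 : climb B (rot G h) h by rewrite /climb porbit_sym porbit_step.
  by apply/idP/idP; apply: connect_trans; apply: connect1.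
move=> hB; apply/proper_card/properP; split.
  apply/subsetP => y; apply: connect_trans; apply: connect1.
  by rewrite /climb hB eqxx orbT.
by exists h; [apply: connect0 | apply: acyc].
Qed.

End Bmap.

Lemma ordS_neq k (t : 'I_k) : 1 < k -> ordS t != t.
Proof.
move=> hk; apply/negP => /eqP/(congr1 val) /=.
have [lt_t|] := ltnP t.+1 k; first by rewrite modn_small // => /eqP;
  rewrite eqn_leq ltnn.
move=> le_k; have tE : t.+1 = k by apply/eqP; rewrite eqn_leq ltn_ord.
by rewrite tE modnn => t0; rewrite -tE -t0 in hk.
Qed.

(** * Arborescences of constellations *)

Section Outgoing.
Variables (k : nat) (C : constellation k) (A : {set {set dart C}}).
Implicit Types x y z h : dart C.

(** The darts along which the edges of [A], oriented from type [t] to type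
    [t + 1], leave their origin. *)
Definition outgoing : {set dart C} := [set h | fblack h & edge h \in A].

Hypothesis hC : is_constellation C.

Lemma constellation_oppK : involutive (opp C).
Proof. by case: hC => [[[]]]. Qed.

Lemma constellation_opp_neq h : opp C h != h.
Proof. by case: hC => [[_ nb]] _ _ _ _; apply: nb. Qed.

Lemma fblack_opp h : fblack (opp C h) = ~~ fblack h.
Proof. by case: hC. Qed.

Lemma vtype_rot h : vtype (rot C h) = vtype h.
Proof. by case: hC => _ _ vt _ _; apply: vt; apply: porbit_step. Qed.

Lemma vtype_face_perm h : vtype (face_perm C h) = vtype (opp C h).
Proof. by rewrite permM -[in RHS](permKV (rot C) (opp C h)) vtype_rot. Qed.

Lemma vtype_opp_black h : fblack h -> vtype (opp C h) = ordS (vtype h).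
Proof. by move=> hb; rewrite -vtype_face_perm; case: hC => _ _ _ _ /(_ h hb)[].
  Qed.

Lemma etype_opp h : etype (opp C h) = etype h.
Proof. by rewrite /etype fblack_opp constellation_oppK; case: (fblack h). Qed.

Lemma vtype_white h : ~~ fblack h -> vtype h = ordS (etype h).
Proof.
move=> hw; rewrite /etype (negPf hw) -vtype_opp_black ?fblack_opp //.
by rewrite constellation_oppK.
Qed.

Lemma edge_outgoing_inj : {in outgoing &, injective (@edge C)}.
Proof.
move=> x y; rewrite !inE => /andP[xb _] /andP[yb _].
case/(edge_eq constellation_oppK) => // xy.
by rewrite xy fblack_opp yb in xb.
Qed.

(** An edge of type [t] has its black half at a vertex of type [t] and its white half at one of type
    [t + 1], which differs from [t] since [1 < k]. So an edge with the type of its vertex meets it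
    by its black half only. *)
Lemma edges_outgoing h : 1 < k -> A \subset edges C ->
  #|[set e in A | ~~ [disjoint e & vertex h]
                & [exists x in e, etype x == vtype h]]|
  = #|outgoing :&: vertex h|.
Proof.
move=> hk Asub; rewrite -(card_in_imset (f := @edge C)); last first.
  by move=> x y; rewrite !in_setI => /andP[xo _] /andP[yo _];
    apply: edge_outgoing_inj.
apply: eq_card => e; rewrite inE; apply/idP/idP.
  case/and3P => eA /pred0Pn[z /= /andP[ze zh]] /exists_inP[x xe /eqP xt].
  have /imsetP[y _ eE] := subsetP Asub e eA.
  have {}eE : e = edge z by apply/esym/eqP;
    rewrite eE eq_porbit_mem -/(edge y) -eE.
  have zt : etype z = vtype h.
    rewrite -xt; move: xe; rewrite eE (edgeE _ constellation_oppK) !inE.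
    by case/orP=> /eqP->; rewrite ?etype_opp.
  have vz : vtype z = vtype h.
    by apply: (vertex_const (f := @vtype k C)) zh => y'; rewrite vtype_rot.
  rewrite eE; apply: imset_f; rewrite !inE zh -eE eA !andbT.
  apply: contraT => /vtype_white; rewrite zt vz => tE.
  by have := ordS_neq (vtype h) hk; rewrite -tE eqxx.
case/imsetP => z; rewrite !inE => /andP[/andP[zb zA] zh] ->.
rewrite zA /=; apply/andP; split.
  by apply/pred0Pn; exists z; rewrite /= porbit_id.
apply/existsP; exists z; rewrite porbit_id /etype zb.
by rewrite (vertex_const (f := @vtype k C) _ zh) ?eqxx // => y;
  rewrite vtype_rot.
Qed.

(** Acyclicity of the tree forbids closed climbs, which gives the depth. Each vertex other than
    [vertex h0] allows a further climb, so every climb can be continued to [vertex h0]; an outgoing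
    dart there would close a cycle. *)
Lemma arborescence_outgoing h0 : 1 < k -> arborescence (vertex h0) A ->
  [/\ separates (rot C) outgoing,
      forall h, vertex h != vertex h0 -> exists2 x, x \in outgoing & x \in
        vertex h,
      forall h, h \in outgoing -> h \notin vertex h0 &
      exists d : dart C -> nat,
       (forall h, d (rot C h) = d h) /\
       (forall h, h \in outgoing -> d (opp C h) < d h)].
Proof.
move=> hk [_ [Asub _ Aacyc] Aone].
have card1 h : vertex h != vertex h0 -> #|outgoing :&: vertex h| = 1.
  by move=> /Aone; rewrite edges_outgoing.
have out1 h : vertex h != vertex h0 -> exists2 x, x \in outgoing & x \in vertex
  h.
  move/card1/eqP/cards1P => [x xE]; have := set11 x; rewrite -xE inE.
  by case/andP; exists x.
have acyc h : h \in outgoing -> ~~ connect (climb outgoing) (opp C h) h.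
  move=> ho; apply/negP => /(@climb_cycle _ A _ _ constellation_oppK _ _
    ho)[||s /Aacyc//].
    by move=> g; rewrite inE => /andP[].
  by move=> g; rewrite !inE fblack_opp => /andP[->].
have [d [dr dout]] := climb_grading acyc.
have climb_root x : connect (climb outgoing) x h0.
  have [n] := ubnP (d x); elim: n x => // n IH x lt_n.
  have [/eqP|/out1[h ho hx]] := boolP (vertex x == vertex h0).
    move/eqP; rewrite vertex_eq => xh0; apply: connect1.
    by rewrite /climb porbit_sym xh0.
  apply: (@connect_trans _ _ h); first by apply: connect1; rewrite /climb hx.
  apply: (@connect_trans _ _ (opp C h)).
    by apply: connect1; rewrite /climb ho eqxx orbT.
  by apply: IH; rewrite (leq_trans (dout h ho)) // (vertex_const dr hx).
have out0 h : h \in outgoing -> h \notin vertex h0.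
  move=> ho; apply: contra (acyc h ho) => hh0.
  by apply: (connect_trans (climb_root _)); apply: connect1; rewrite /climb hh0.
split=> //; last by exists d.
move=> x y xo yo xy.
have /card1/eqP/cards1P[z zE] : vertex x != vertex h0.
  by apply: contra (out0 x xo); rewrite vertex_eq.
have: x \in outgoing :&: vertex x by rewrite inE xo mem_vertex.
have: y \in outgoing :&: vertex x by rewrite inE yo.
by rewrite zE !inE => /eqP-> /eqP->.
Qed.

(** Sending an outgoing dart to its vertex is a bijection onto the vertices other than
    [vertex h0]. *)
Lemma card_outgoing h0 t : 1 < k -> arborescence (vertex h0) A ->
  #|[set h in outgoing | vtype h == t]| = num_vertices C t - (t == vtype h0).
Proof.
move=> hk hA; have [sep out1 out0 _] := arborescence_outgoing hk hA.
have vE h x : x \in vertex h -> vtype x = vtype h.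
  by apply: vertex_const => y; rewrite vtype_rot.
rewrite /num_vertices (cardsD1 (vertex h0)) inE imset_f //.
have -> : [exists h in vertex h0, vtype h == t] = (t == vtype h0).
  apply/existsP/eqP => [[h /andP[/vE-> /eqP//]]|->]; exists h0.
  by rewrite mem_vertex eqxx.
rewrite addKn -(card_in_imset (f := @vertex C)); last first.
  move=> x y; rewrite inE => /andP[xo _]; rewrite inE => /andP[yo _] /esym/eqP.
  by rewrite vertex_eq; apply: sep.
apply: eq_card => v; rewrite !inE; apply/idP/idP.
  case/imsetP => h; rewrite inE => /andP[ho ht] ->;
    rewrite vertex_eq out0 // imset_f //=.
  by apply/existsP; exists h; rewrite mem_vertex.
case/and3P => nv0 /imsetP[h _ vE'] /existsP[g /andP[gv gt]];
  rewrite vE' in nv0 gv *.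
have [x xo xh] := out1 h nv0.
have -> : vertex h = vertex x by apply/esym/eqP; rewrite vertex_eq.
by rewrite imset_f // inE xo (vE _ _ xh) -(vE _ _ gv).
Qed.

End Outgoing.

(** * The dual-opening *)

Section Opening.
Variables (k : nat) (X : constellation_with_edges k).
Hypothesis hX : is_constellation X.
Local Notation N := (dual_opening X).
Implicit Types (h x y : dart X).

Definition buds (M : nebula k) (b : bool) : {set dart M} :=
  [set h | bud h & vblack h == b].

Lemma opp_opening h : opp N h = if edge h \in tset X then h else opp X h.
Proof. by rewrite permE. Qed.

Lemma bud_opening h : @bud N h = (edge h \in tset X).
Proof.
rewrite /bud opp_opening; case: ifP => _; first exact: eqxx.
exact: negPf (constellation_opp_neq hX h).
Qed.

Lemma buds_opening h b : (h \in buds N b) = (edge h \in tset X) && (fblack h ==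
  b).
Proof. by rewrite inE bud_opening. Qed.

Lemma opening_oppK : involutive (opp N).
Proof.
move=> h; rewrite (opp_opening h); case: ifP => hA;
  rewrite opp_opening ?edge_opp hA //.
exact: constellation_oppK.
Qed.

(** The two involutions agree off the cut edges, so their product swaps the two buds of each cut
    edge and fixes every other dart. *)
Lemma pairing_opening :
  pairing (buds N true) (buds N false) (opp X * opp N : {perm dart X})%g.
Proof.
have mE h : (opp X * opp N : {perm dart X})%g h = if edge h \in tset X then opp
  X h else h.
  by rewrite permM opp_opening edge_opp (constellation_oppK hX).
split=> h.
- rewrite (mE h); case: ifP => hA; rewrite mE ?edge_opp hA //.
  exact: constellation_oppK.
- by rewrite !buds_opening mE => /andP[hA /eqP hb];
  rewrite hA edge_opp hA fblack_opp ?hb.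
- by rewrite !buds_opening mE => /andP[hA /eqP hb];
  rewrite hA edge_opp hA fblack_opp ?hb.
rewrite inE !buds_opening mE; case: ifP => //= _; by case: fblack.
Qed.

Lemma face_opening h : opp X (face_perm N h) = rot X (opp N h).
Proof.
by rewrite permM /= -[in RHS](permKV (face_perm X) (opp N h)) permM permKV.
Qed.

(** Conjugation by [opp X] turns this permutation into [rot X] and the white buds into the outgoing
    darts. *)
Lemma separates_opening h0 : 1 < k -> arborescence (vertex h0) (tset X) ->
  separates ((opp X * opp N : {perm dart X}) * face_perm N)%g (buds N false).
Proof.
move=> hk hA x y; rewrite !buds_opening => /andP[xA /eqP xb] /andP[yA /eqP yb]
  xy.
have [sep _ _ _] := arborescence_outgoing hX hk hA.
apply: (@perm_inj _ (opp X)); apply: sep.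
- by rewrite inE edge_opp xA fblack_opp ?xb.
- by rewrite inE edge_opp yA fblack_opp ?yb.
rewrite (porbit_morph (s :=
  ((opp X * opp N : {perm dart X}) * face_perm N)%g)) //.
  exact: perm_inj.
by move=> z; rewrite permM face_opening permM opening_oppK.
Qed.

(** Conjugation by [opp X] turns the face permutation into the contour [m * rot X] of the tree. Each
    of its orbits is stable under [m], hence under [rot X], and the tree is connected. *)
Lemma opening_one_face h0 : 1 < k -> arborescence (vertex h0) (tset X) ->
  forall x y, y \in @face N x.
Proof.
move=> hk hA; have [sep _ _ [d [dr dout]]] := arborescence_outgoing hX hk hA.
pose m := (opp X * opp N : {perm dart X})%g.
have mK : involutive m by case: pairing_opening.
have mE h : m h = if edge h \in tset X then opp X h else h.
  by rewrite permM opp_opening edge_opp (constellation_oppK hX).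
have mP x : m x \in porbit (m * rot X)%g x.
  apply: (contour_returns x mK sep dr) => h.
    by move=> ho; rewrite mE; move: (ho); rewrite inE => /andP[_ ->];
      apply: dout.
  rewrite mE; case: ifP => hh; last by rewrite eqxx.
  by rewrite !inE fblack_opp // edge_opp hh !andbT; case: fblack;
    [left | right].
have rP x : rot X x \in porbit (m * rot X)%g x.
  have := mP (m x); rewrite mK => xm.
  have -> : porbit (m * rot X)%g x = porbit (m * rot X)%g (m x).
    by apply/eqP; rewrite eq_porbit_mem.
  by have := porbit_step (m * rot X)%g (m x);
    rewrite [in X in X \in _ -> _]permM mK.
have all x y : y \in porbit (m * rot X)%g x.
  case: hA => _ [_ conn _] _.
  apply: (connect_ind (P := fun z => z \in porbit (m * rot X)%g x) _ _ (conn x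
    y)).
    move=> z t xz /orP[zt|/andP[zA /eqP->]]; apply: porbit_trans xz _.
      exact: porbit_refine zt.
    by have := mP z; rewrite mE zA.
  exact: porbit_id.
move=> x y; rewrite -(porbit_morph (f := opp X) (t := (m * rot X)%g)) //.
  exact: perm_inj.
by move=> z; rewrite face_opening [RHS]permM /m [in RHS]permM
  (constellation_oppK hX).
Qed.

(** The black buds are the outgoing darts, and their type is that of their vertex in [X]. *)
Lemma opening_num_buds h0 t : 1 < k -> arborescence (vertex h0) (tset X) ->
  num_buds N true t = num_vertices X t - (t == vtype h0).
Proof.
move=> hk hA; rewrite -(card_outgoing hX t hk hA); apply: eq_card => h.
rewrite !inE bud_opening /= /etype eqb_id andbCA.
by case: fblack; rewrite ?andbT ?andbF //= andbA.
Qed.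

Lemma opening_is_nebula h0 : 1 < k -> arborescence (vertex h0) (tset X) ->
  is_nebula N.
Proof.
move=> hk hA; have one := opening_one_face hk hA.
have [_ face_black _ _ face_deg] := hX.
split.
- by split; [exact: opening_oppK | exact: (@one_face_connected N one)].
- apply/eqP/cards1P; exists (face (h0 : dart N)); apply/setP => f; rewrite inE.
  apply/imsetP/eqP => [[h _ ->]|->]; last by exists h0.
  by apply/eqP; rewrite eq_porbit_mem; apply: one.
- exact: face_black.
- move=> h; rewrite opp_opening /=; case: ifP => // _; exact: etype_opp.
- by move=> h; rewrite bud_opening opp_opening => /negPf->; apply: fblack_opp.
- by move=> h /face_deg[].
- move=> h /= hb; have [_ vt] := face_deg h hb.
  by rewrite /etype (face_black h) ?porbit_step // hb.
- move=> h /= hw.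
  have fw : ~~ fblack (face_perm X h) by rewrite (face_black h) ?porbit_step.
  apply: (can_inj (@ordSK k)); rewrite -(vtype_white hX fw).
  by rewrite ord_predK (vtype_face_perm hX) /etype (negPf hw).
(* [opp X] exchanges the black and the white bud of each cut edge. *)
- move=> t; rewrite /num_buds -(card_imset _ (@perm_inj _ (opp X)));
  apply: eq_card => h.
  rewrite [RHS]inE bud_opening /=; apply/imsetP/idP.
    case=> g; rewrite inE bud_opening /= => /and3P[gA gb gt] ->.
    by rewrite edge_opp gA fblack_opp // (eqP gb) etype_opp.
  case/and3P=> hA' /eqP hb ht; exists (opp X h);
    last by rewrite (constellation_oppK hX).
  by rewrite inE bud_opening /= edge_opp hA' fblack_opp // hb etype_opp.
Qed.

End Opening.

(** * Invariance under isomorphism and injectivity *)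

Lemma perm_morphV (T U : finType) (f : T -> U) (s : {perm T}) (t : {perm U}) :
  (forall x, f (s x) = t (f x)) -> forall x, f (s^-1%g x) = t^-1%g (f x).
Proof. by move=> fst x; apply: (@perm_inj _ t); rewrite -fst !permKV. Qed.

Lemma imset_edge (G H : bmap) (f : dart G -> dart H) h :
    involutive (opp G) -> involutive (opp H) ->
    (forall x, f (opp G x) = opp H (f x)) ->
  f @: edge h = edge (f h).
Proof.
by move=> oK oK' fo; rewrite !edgeE // -fo; apply/setP => x;
  rewrite imsetU !imset_set1.
Qed.

Lemma dual_opening_iso k (X Y : constellation_with_edges k) :
    is_constellation X -> is_constellation Y ->
  tree_pointed_iso X Y -> nebula_iso (dual_opening X) (dual_opening Y).
Proof.
move=> hX hY [f [[[g fK gK] fr fo] fb fv froot ft]]; exists f.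
have f_inj := can_inj fK.
have fe h : f @: edge h = edge (f h).
  by apply: imset_edge => //; apply: constellation_oppK.
have fA h : (edge (f h) \in tset Y) = (edge h \in tset X).
  rewrite -ft -fe; apply/imsetP/idP => [[e eA /(imset_inj f_inj)->] // | hA].
  by exists (edge h).
split=> //.
  split; first by exists g.
    by move=> h /=; rewrite !permM (perm_morphV fr) fo.
  by move=> h; rewrite !opp_opening fA; case: ifP.
by move=> h /=; rewrite /etype fb -fo !fv.
Qed.

(** The matching of the buds of [Y], pulled back along [f], is again a separated pairing along the
    face of the first nebula. By uniqueness it is the matching given by [X], so [f] respects the
    glueing. *)
Lemma dual_opening_inj k (X Y : constellation_with_edges k) h0 h1 :
    1 < k -> is_constellation X -> is_constellation Y ->
    arborescence (vertex h0) (tset X) -> arborescence (vertex h1) (tset Y) ->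
  nebula_iso (dual_opening X) (dual_opening Y) -> tree_pointed_iso X Y.
Proof.
move=> hk hX hY hA hB [f [[[g fK gK] fr fo] fb ft froot]].
pose N := dual_opening X; pose M := dual_opening Y.
change (dart X -> dart Y) in f; change (dart Y -> dart X) in g.
have {}fb : forall h, fblack (f h) = fblack h := fb.
have {}ft : forall h, etype (f h) = etype h := ft.
have f_inj : injective f := can_inj fK.
pose m := (opp X * opp N : {perm dart X})%g.
pose m' := (opp Y * opp M : {perm dart Y})%g.
have fbud h : (edge (f h) \in tset Y) = (edge h \in tset X).
  by rewrite -!bud_opening // /bud -fo; apply: inj_eq.
have fbuds h b : (f h \in buds M b) = (h \in buds N b).
  by rewrite !buds_opening // fbud fb.
have fface h : f (face_perm N h) = face_perm M (f h).
  by rewrite !permM (perm_morphV fr) fo.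
have m2_inj : injective (fun x => g (m' (f x))).
  by apply: inj_comp (can_inj gK) _; apply: inj_comp perm_inj f_inj.
pose m2 : {perm dart X} := perm m2_inj.
have fm2 x : f (m2 x) = m' (f x) by rewrite permE gK.
have [m'K m'O m'C m'0] : pairing (buds M true) (buds M false) m' :=
  pairing_opening hY.
have fm h : f (m h) = m' (f h).
  rewrite -fm2; congr (f (fun_of_perm _ h)).
  apply: (pairing_unique (s := face_perm N) (r := h0) (O := buds N true) (C :=
    buds N false)).
  - rewrite -setI_eq0; apply/eqP/setP => x;
    rewrite in_setI !buds_opening // inE.
    by case: (fblack x); rewrite !andbF.
  - by apply/subsetP => x _; apply: (opening_one_face hX hk hA).
  - exact: pairing_opening.
  - split=> x.
    + by apply: f_inj; rewrite !fm2 m'K.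
    + by rewrite -!fbuds fm2; apply: m'O.
    + by rewrite -!fbuds fm2; apply: m'C.
    + by rewrite inE -!fbuds -in_setU => /m'0; rewrite -fm2; apply: f_inj.
  - exact: separates_opening hA.
  - move=> x y; rewrite -!fbuds => xC yC xy; apply: (f_inj).
    apply: (separates_opening hY hk hB xC yC).
    rewrite (porbit_morph (s := (m2 * face_perm N)%g) x y f_inj) // => z.
    by rewrite permM fface fm2 -permM.
have fopp h : f (opp X h) = opp Y (f h).
  have oE : opp X h = opp N (m h) by rewrite permM opening_oppK.
  have oE' : opp Y (f h) = opp M (m' (f h)) by rewrite permM opening_oppK.
  by rewrite oE oE' fo fm.
have fe h : f @: edge h = edge (f h).
  by apply: imset_edge => //; apply: constellation_oppK.
exists f; split=> //.
- split=> //; first by exists g.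
  move=> h; have rE : rot X h = opp X (face_perm N (opp N h)).
    by rewrite face_opening opening_oppK.
  have rE' : rot Y (f h) = opp Y (face_perm M (opp M (f h))).
    by rewrite face_opening opening_oppK.
  by rewrite rE rE' fopp fface fo.
(* Vertex types are recovered from edge types: equal at black darts, shifted by one at white
   darts. *)
- move=> h; have [hb|hw] := boolP (fblack h).
    by have := ft h; rewrite /etype fb hb.
  by rewrite !vtype_white // ?fb //; congr ordS; apply: ft.
have [[_ [Xsub _ _] _] [_ [Ysub _ _] _]] := (hA, hB).
apply/setP => e; apply/imsetP/idP => [[e' eA ->]|eB].
  have /imsetP[h _ eE] := subsetP Xsub _ eA.
  by rewrite eE fe fbud -eE.
have /imsetP[h _ eE] := subsetP Ysub _ eB.
exists (edge (g h)); first by rewrite -fbud gK -eE.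
by rewrite fe gK.
Qed.

(** * Closing a nebula *)

Lemma nebula_iso_num_buds k (N M : nebula k) b t :
  nebula_iso N M -> num_buds N b t = num_buds M b t.
Proof.
move=> [f [[[g fK gK] fr fo] fb ft _]]; have f_inj := can_inj fK.
have fbud h : bud (f h) = bud h by rewrite /bud -fo; apply: inj_eq.
rewrite /num_buds -(card_imset _ f_inj); apply: eq_card => h; rewrite [RHS]inE.
apply/imsetP/idP => [[x + ->]|hP]; first by rewrite inE fbud fb ft.
by exists (g h); rewrite ?gK // inE -fbud -fb -ft gK.
Qed.

Lemma card_buds k (N : nebula k) : is_nebula N -> #|buds N true| = #|buds N
  false|.
Proof.
move=> hN; have sum_buds b : #|buds N b| = \sum_t num_buds N b t.
  rewrite -sum1_card (partition_big (@htype k N) predT) //=;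
    apply: eq_bigr => t _.
  by rewrite /num_buds -sum1_card; apply: eq_bigl => h; rewrite !inE andbA.
by rewrite !sum_buds; apply: eq_bigr => t _; apply: nebula_balanced.
Qed.

Lemma nebula_closing k (N : nebula k) : 1 < k -> is_rooted_nebula N ->
  exists (X : constellation_with_edges k) (h0 : dart X),
    [/\ is_rooted_constellation X, arborescence (vertex h0) (tset X) &
        nebula_iso (dual_opening X) N].
Proof.
move=> hk [hN [r r_black rE]].
have [[oNK _] _ vb hto vbo degb rotb rotw _] := hN.
pose psi := face_perm N.
have one x y : y \in porbit psi x.
  have /cards1P[F FE] : #|faces N| == 1 by apply/eqP/nebula_one_face.
  have faceF z : face z = F by apply/set1P; rewrite -FE imset_f.
  by rewrite -/(face x) faceF -(faceF y) porbit_id.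
have vbV x : vblack ((rot N)^-1%g x) = vblack x.
  by rewrite -[in RHS](permKV (rot N) x) (vb _ _ (porbit_step _ _)).
have htV_black x : vblack x -> htype ((rot N)^-1%g x) = ord_pred (htype x).
  by move=> xb; rewrite -[in RHS](permKV (rot N) x) rotb ?vbV // ordSK.
have htV_white x : ~~ vblack x -> htype ((rot N)^-1%g x) = ordS (htype x).
  by move=> xw; rewrite -[in RHS](permKV (rot N) x) rotw ?vbV // ord_predK.
(* Type of the vertex, in the glued map, of the other half of the edge of [x]. *)
pose w (x : dart N) := if vblack x then ordS (htype x) else htype x.
have psiE x : psi x = (rot N)^-1%g (opp N x) by rewrite permM.
(* Black buds open and lower [w] by one, white buds close and raise it by one, and [w] is preserved
   at complete edges. *)
have [||||||m [d [z0 [[[mK mO mC m0] sep] wm dm dmC root]]]] :=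
    @matching_exists _ _ (@ordS k) (@ord_pred k) w psi (buds N true) (buds N
      false) r
      (@ord_predK k).
- rewrite -setI_eq0; apply/eqP/setP => x; rewrite !inE.
  by case: (bud x) (vblack x) => [] [].
- exact: card_buds.
- by apply/subsetP => x _; apply: one.
- move=> x; rewrite inE => /andP[/eqP xb /eqP xB].
  by rewrite /w psiE xb vbV xB htV_black // ordSK ord_predK.
- move=> x; rewrite inE => /andP[/eqP xb /eqP xB].
  by rewrite /w psiE xb vbV xB htV_white ?xB.
- move=> x; rewrite !inE -andb_orr eqbF_neg eqb_id orbN andbT => nb.
  rewrite /w psiE vbV vbo //; have [xB|xW] := boolP (vblack x) => /=.
    by rewrite htV_white ?vbo ?xB // hto.
  by rewrite htV_black ?vbo // hto ord_predK.
have mbud x : bud (m x) = bud x.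
  have [xb|nb] := boolP (bud x);
    last by rewrite m0 ?(negPf nb) // !inE (negPf nb).
  have [xB|xW] := boolP (vblack x).
    by have := mO x; rewrite !inE xb xB => /(_ isT)/andP[].
  by have := mC x; rewrite !inE xb (negPf xW) => /(_ isT)/andP[].
have mF x : ~~ bud x -> m x = x by move=> nb; rewrite m0 // !inE (negPf nb).
have vbm x : bud x -> vblack (m x) = ~~ vblack x.
  move=> xb; have [xB|xW] := boolP (vblack x).
    by have := mO x; rewrite !inE xb xB => /(_ isT)/andP[_ /eqP].
  by have := mC x; rewrite !inE xb (negPf xW) => /(_ isT)/andP[_ /eqP].
(* Invariance of [w] under [m * psi], read at a closing bud, says that the matched buds have the
   same type. *)
have htm_white x : bud x -> ~~ vblack x -> htype (m x) = htype x.
  move=> xb xW; have := wm x; rewrite permM /w psiE vbV.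
  have mb : opp N (m x) = m x by apply/eqP; rewrite -[_ == _]/(bud (m x)) mbud.
  rewrite mb vbm // (negPf xW) /= htV_black ?vbm // => <-.
  by rewrite ord_predK.
have htm x : bud x -> htype (m x) = htype x.
  move=> xb; have [xB|] := boolP (vblack x); last exact: htm_white.
  by rewrite -[in RHS](mK x) (htm_white (m x)) ?mbud // vbm // xB.
have oNb x : bud x -> opp N x = x by move/eqP.
have oNbud x : bud (opp N x) = bud x by rewrite /bud oNK eq_sym.
pose o : {perm dart N} := (opp N * m)%g.
have oE x : o x = if bud x then m x else opp N x.
  by rewrite permM; case: ifP => [/oNb->//|/negbT nb]; rewrite mF // oNbud.
have oK : involutive o.
  by move=> x; rewrite (oE x); case: ifP => xb; rewrite oE ?mbud ?oNbud xb.
have vo x : vblack (o x) = ~~ vblack x.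
  by rewrite oE; case: ifP => [/vbm//|/negbT/vbo].
have ho x : htype (o x) = htype x.
  by rewrite oE; case: ifP => [/htm|_]; rewrite ?hto.
(* Chosen so that the face permutation of the glued map is [rot N]: its faces are the vertices of
   [N]. *)
pose rho : {perm dart N} := ((rot N)^-1 * o)%g.
(* Through [o], the vertices of the glued map are the orbits of [m * psi], which carry [w], [d] and
   the separation property. *)
have orho x : o (rho x) = (m * psi)%g (o x).
  have oE' : o x = m (opp N x) by rewrite permM.
  by rewrite [rho x]permM oK [RHS]permM oE' mK psiE oNK.
have orbE x y : (y \in porbit rho x) = (o y \in porbit (m * psi)%g (o x)).
  by rewrite (porbit_morph x y (@perm_inj _ o) orho).
pose vt (x : dart N) := if vblack x then htype x else ordS (htype x).
have vtE x : vt x = w (o x) by rewrite /vt /w vo ho; case: vblack.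
pose C := @Constellation k (BMap rho o) (@vblack k N) vt (nroot N).
have CfE : face_perm C = rot N :> {perm dart N}.
  by rewrite /face_perm /= /rho invMg invgK mulKVg.
pose A : {set {set dart C}} := [set @edge C h | h in [set h : dart N | bud h]].
have edgeA (h : dart N) : (@edge C h \in A) = bud h.
  apply/imsetP/idP => [[g]|hb]; last by exists h; rewrite ?inE ?hb.
  rewrite inE => gb /(edge_eq (G := C) oK)[->//|->].
  by rewrite /= oE gb mbud.
have nbud (h : dart N) : ~~ @bud C h.
  by apply/negP => /eqP /= hE; have := vo h; rewrite hE; case: vblack.
have Asub : A \subset edges C.
  by apply/subsetP => _ /imsetP[h _ ->]; apply: imset_f; rewrite inE nbud.
have Aconn : connected_by A.
  (* Follow the single face of [N] seen through [o]: a bud means crossing a glued edge, and all the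
     rest stays at one vertex. *)
  have oconn x y : connect (step A) (o x) (o y).
    apply: (porbit_closed (P :=
      fun z => connect (step A) (o x) (o z)) _ _ (one x y)).
      move=> z xz; apply: connect_trans xz _.
      apply: (@connect_trans _ _ (opp N z)).
        have [zb|nb] := boolP (bud z); last by rewrite oE (negPf nb).
        rewrite oNb // -[in X in connect _ _ X](oK z).
        by apply: (@step_opp C); rewrite edgeA oE zb mbud.
      have -> : o (psi z) = rho (opp N z) by rewrite psiE [RHS]permM.
      exact: (@step_vertex C) (porbit_step _ _).
    exact: connect0.
  by move=> x y; rewrite -(oK x) -(oK y).
have Cconn : connected_by (edges C).
  move=> x y; apply: connect_sub (Aconn x y) => {}x {}y /orP[xy|/andP[xA
    /eqP->]].
    exact: step_vertex.
  by apply: step_opp; apply: (subsetP Asub).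
have hC : is_constellation C.
  split.
  - by split; first split.
  - by move=> h h'; rewrite /face CfE; apply: vb.
  - move=> h h' /(vertex_const (G := C) (f := vt)); apply=> x.
    by rewrite !vtE /= orho wm.
  - exact: vo.
  - move=> h; rewrite /= => hb; rewrite /face CfE; split; first exact: degb.
    by rewrite /= /vt (vb _ _ (porbit_step _ _)) hb rotb.
have outE (h : dart N) : (h \in outgoing A) = vblack h && bud h.
  by rewrite inE edgeA.
have oout h : h \in outgoing A -> o h \in buds N false.
  by rewrite !inE edgeA vo => /andP[/= -> hb]; rewrite oE hb mbud hb.
have Csep : separates (rot C) (outgoing A).
  move=> x y xo yo; rewrite /= orbE => xy; apply: (@perm_inj _ o).
  by apply: sep xy; apply: oout.
(* The root orbit of the matching is that of [z0], so its vertex in [C] is that of [o z0]. *)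
exists (@ConstellationWithEdges k C A), (o z0); split.
- by split=> //; exists r; rewrite // /face CfE.
- split; first exact: imset_f.
  + split=> //; apply: (graded_acyclic (G := C) (A := A) (d :=
    fun x => d (o x)) Csep oK) => h.
    * by rewrite /= orho dm.
    * move=> ho'; have := dmC _ (oout h ho'); move: ho';
      rewrite inE edgeA => /andP[_ hb].
      by rewrite /= oK oE hb mK => ->.
    * by rewrite edgeA !inE edge_opp !edgeA /= vo => ->; rewrite !andbT;
      case: vblack; [left | right].
  (* The orbit of [o h] is not the root, so it has a closing bud [y], and [o y] is outgoing at [h];
     uniqueness is [Csep]. *)
  + move=> h hz0; rewrite edges_outgoing //.
    have oh : o h \notin porbit (m * psi)%g z0.
      by rewrite -[z0]oK -orbE; move: hz0; rewrite vertex_eq.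
    have [y yC yh] := root _ (one r (o h)) oh.
    have yo : o y \in outgoing A.
      by move: yC; rewrite outE vo oE inE => /andP[yb /eqP->]; rewrite yb mbud.
    have oyh : o y \in @vertex C h by rewrite /vertex /= orbE oK.
    apply/eqP/cards1P; exists (o y); apply/setP => x; rewrite !in_setI in_set1.
    apply/andP/eqP => [[xo xh]|->]; last by split.
    apply: Csep => //; rewrite -[_ \in _]vertex_eq.
    by rewrite (eqP (_ : vertex x == vertex h)) vertex_eq //.
exists id; split.
- split; first by exists id.
    by move=> h; rewrite /= CfE.
  by move=> h; rewrite opp_opening /= edgeA oE;
    have [hb|//] := boolP (@bud N h); rewrite oNb.
- by [].
- move=> h; rewrite /= /etype /= /vt vo ho; by case: vblack.
by rewrite imset_id.
Qed.

Theorem theorem5p2 (k : nat) (p : 'I_k -> nat) (hk : 2 <= k) :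
  bijection_on_classes
    (fun X : constellation_with_edges k =>
       is_tree_pointed X /\ has_reduced_type X p)
    (@tree_pointed_iso k)
    (fun N : nebula k => is_rooted_nebula N /\ has_nebula_type N p)
    (@nebula_iso k)
    (@dual_opening k).
Proof.
split.
- move=> X [[[hX root] _] [h0 hA pE]]; split; last first.
    by move=> t; rewrite (opening_num_buds hX t hk hA) pE.
  by split; first exact: opening_is_nebula hA.
- by move=> X Y [[[hX _] _] _] [[[hY _] _] _]; apply: dual_opening_iso.
- move=> X Y [[[hX _] _] [h0 hA _]] [[[hY _] _] [h1 hB _]].
  exact: dual_opening_inj hA hB.
(* The reduced type of the glued constellation is read off the bud counts, which isomorphisms
   preserve. *)
move=> N [hN pN]; have [X [h0 [hX hA iso]]] := nebula_closing hk hN.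
exists X => //; split; first by split=> //; exists (vertex h0).
exists h0 => // t; case: hX => hX _.
by rewrite -(opening_num_buds hX t hk hA) (nebula_iso_num_buds true t iso) pN.
Qed.
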